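(* Let $\alpha>-1$, and let $\Theta=\{\theta_1,\theta_2\}$ and $\Phi=\{\varphi_1,\varphi_2\}$, with $\theta_1,\theta_2,\varphi_1,\varphi_2$ bounded holomorphic functions on the unit disk $\mathbb{D}$, both satisfy the corona condition. Then the quotient Hilbert module $(H^2)_\Theta$ is not isomorphic to the quotient Hilbert module $(A^2_\alpha)_\Phi$.
   Context: $\mathbb{D}$ is the open unit disk in $\mathbb{C}$. $H^2$ is the Hardy space of holomorphic $f$ on $\mathbb{D}$ with $\|f\|_2^2=\sup_{0<r<1}\frac{1}{2\pi}\int_0^{2\pi}|f(re^{i\theta})|^2\,d\theta<\infty$. For $\alpha>-1$, $A^2_\alpha$ is the weighted Bergman space of holomorphic $f$ on $\mathbb{D}$ with $\|f\|_{2,\alpha}^2=\frac1\pi\int_{\mathbb{D}}|f(z)|^2(\alpha+1)(1-|z|^2)^\alpha\,dA(z)<\infty$, where $dA$ is area measure. Each is a Hilbert module over $\mathbb{C}[z]$ via $p\cdot f=pf$ (i.e. the coordinate function acts by $M_z f=zf$). A pair $\Theta=\{\theta_1,\theta_2\}$ of bounded holomorphic functions on $\mathbb{D}$ is viewed as the bounded holomorphic function $\Theta(z)=\theta_1(z)\otimes e_1+\theta_2(z)\otimes e_2$ with values in the bounded operators from $\mathbb{C}$ to $\mathbb{C}^2$, where $\{e_1,e_2\}$ is an orthonormal basis of $\mathbb{C}^2$. It satisfies the corona condition if there is $\epsilon>0$ with $|\theta_1(z)|^2+|\theta_2(z)|^2\ge\epsilon$ for all $z\in\mathbb{D}$. For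 $\mathcal{H}$ equal to $H^2$ or $A^2_\alpha$ and such $\Theta$, let $M_\Theta:\mathcal{H}\to\mathcal{H}\otimes\mathbb{C}^2$, $M_\Theta f=\theta_1 f\otimes e_1+\theta_2 f\otimes e_2$; under the corona condition its range $\Theta\mathcal{H}$ is closed. The quotient Hilbert module is $\mathcal{H}_\Theta=(\mathcal{H}\otimes\mathbb{C}^2)/\Theta\mathcal{H}$ with the induced action of $\mathbb{C}[z]$; equivalently it is the Hilbert space $(\operatorname{ran} M_\Theta)^\perp\subseteq\mathcal{H}\otimes\mathbb{C}^2$ on which the coordinate function acts by the compression $N_z=P_{(\operatorname{ran} M_\Theta)^\perp}(M_z\otimes I_{\mathbb{C}^2})|_{(\operatorname{ran} M_\Theta)^\perp}$. Two Hilbert modules over $\mathbb{C}[z]$ are isomorphic if there is a unitary operator $X$ between them with $X(p\cdot f)=p\cdot(Xf)$ for all $p\in\mathbb{C}[z]$ and all $f$. *)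

(* Defs.v *)
From HB Require Import structures.
From mathcomp Require Import all_boot all_order all_algebra.
From mathcomp Require Import all_classical all_reals all_analysis.
From mathcomp Require Import measurable_realfun complex ring_quotient.
From mathcomp Require Import ring lra.

Set Implicit Arguments.
Unset Strict Implicit.
Unset Printing Implicit Defensive.

Import Order.TTheory GRing.Theory Num.Theory.
Import numFieldNormedType.Exports.
Import Normc.

Local Open Scope classical_set_scope.
Local Open Scope ring_scope.
Local Open Scope complex_scope.
Local Open Scope quotient_scope.

(* [R[i]^o] carries the topology of the norm of the numeric field [R[i]];
   it is made available on [R[i]] itself, so that [derivable f z 1] is complex
   differentiability at [z]. *)
HB.instance Definition _ (R : realType) := NormedModule.copy R[i] R[i]^o.

Section Disk.
Variable R : realType.
Local Notation C := R[i].
Implicit Types (f g h : C -> C) (z : C).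

Definition disk : set C := [set z | normc z < 1].

(* Values outside the disk are irrelevant. *)
Definition holomorphic f := forall z, disk z -> derivable f z 1.

Definition bounded_on_disk f :=
  exists M : R, forall z, disk z -> normc (f z) <= M.

Definition bounded_holomorphic f := holomorphic f /\ bounded_on_disk f.

Definition corona (theta1 theta2 : C -> C) :=
  exists2 eps : R, 0 < eps & forall z, disk z ->
    eps <= normc (theta1 z) ^+ 2 + normc (theta2 z) ^+ 2.

Definition circle (r t : R) : C := (r * cos t) +i* (r * sin t).

Definition hardy_mean (r : R) f : \bar R :=
  (((2 * pi)^-1)%:E * \int[lebesgue_measure]_(t in `[0%R, (2 * pi)%R])
     (normc (f (circle r t)) ^+ 2)%:E)%E.

Definition hardy_sqnorm f : \bar R :=
  ereal_sup [set hardy_mean r f | r in [set r : R | 0 < r < 1]].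

Definition bergman_sqnorm (alpha : R) f : \bar R :=
  ((pi^-1)%:E *
    \int[lebesgue_measure \x lebesgue_measure]_(p in [set p : R * R |
        disk (p.1 +i* p.2)])
      (normc (f (p.1 +i* p.2)) ^+ 2 *
        ((alpha + 1) * (1 - normc (p.1 +i* p.2) ^+ 2) `^ alpha))%:E)%E.

(* The axiom is what makes the holomorphic functions with [N f < +oo] a vector
   space stable under multiplication by polynomials. *)
Record holo_sqnorm := HoloSqNorm {
  sqnorm :> (C -> C) -> \bar R;
  sqnorm_dom : forall (a b : R) f g h, 0 <= a -> 0 <= b ->
    holomorphic f -> holomorphic g -> holomorphic h ->
    (forall z, disk z ->
      normc (h z) ^+ 2 <= a * normc (f z) ^+ 2 + b * normc (g z) ^+ 2) ->
    (sqnorm h <= a%:E * sqnorm f + b%:E * sqnorm g)%E }.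

End Disk.

Section Domination.
Variable R : realType.
Local Notation C := R[i].
Implicit Types (f g h : C -> C) (z : C).

Lemma normc_ge0 z : 0 <= normc z.
Proof. by case: z => a b; rewrite /normc sqrtr_ge0. Qed.

Lemma normrC z : `|z| = (normc z)%:C.
Proof. by case: z. Qed.

Lemma cplx_continuous : continuous (fun p : R * R => p.1 +i* p.2 : C).
Proof.
move=> p; apply/cvgrPdist_lt => -[e e'] /= /andP[/eqP -> e0]; near=> q.
rewrite normrC ltcR; apply: (@le_lt_trans _ _ (`|p.1 - q.1| + `|p.2 - q.2|)).
  rewrite -(@ler_pXn2r _ 2)// ?nnegrE ?addr_ge0 ?normc_ge0//.
  rewrite /normc /= sqr_sqrtr ?addr_ge0 ?sqr_ge0// [leRHS]sqrrD !real_normK ?num_real//.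
  by rewrite addrAC lerDl mulrn_wge0// mulr_ge0.
rewrite (splitr e) ltrD//; near: q.
- apply: (@cvgr_dist_lt _ _ _ _ _ fst p.1 (@cvg_fst _ _ _ _ _)).
  by rewrite divr_gt0.
- apply: (@cvgr_dist_lt _ _ _ _ _ snd p.2 (@cvg_snd _ _ _ _ _)).
  by rewrite divr_gt0.
Unshelve. all: by end_near.
Qed.

Lemma normc_continuous : continuous (@normc R : C -> R).
Proof.
move=> z; apply/(@cvgrPdist_lt _ _ _ (nbhs z)) => e e0; near=> w.
apply: (@le_lt_trans _ _ (normc (z - w))).
  have nB x y : normc x <= normc y + normc (x - y) :> R.
    by rewrite -{1}(subrK y x) addrC le_normcD.
  rewrite ler_norml lerNl opprB !lerBlDl nB andbT.
  by rewrite -(normcN (z - w)) opprB.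
rewrite -ltcR -normrC; near: w.
by apply/(@nbhs_normP C C); exists e%:C; rewrite /= ?ltcR.
Unshelve. all: by end_near.
Qed.

Lemma holomorphic_continuous f z :
  holomorphic f -> disk z -> {for z, continuous f}.
Proof.
by move=> hf /hf /derivable1_diffP; exact: differentiable_continuous.
Qed.

Lemma open_measurable2 (U : set (R * R)) : open U -> measurable U.
Proof.
move=> oU.
pose I := ((rat * rat) * (rat * rat))%type.
pose B (i : I) : set (R * R) :=
  [set` `]ratr i.1.1, ratr i.1.2[] `*` [set` `]ratr i.2.1, ratr i.2.2[].
have -> : U = \bigcup_(i in [set: I]) (if `[< B i `<=` U >] then B i else set0).
  apply/seteqP; split => [p Up|p [i _]]; last by case: asboolP => // BU /BU.
  have /nbhs_ballP[e /= e0 eU] : nbhs p U by exact: open_nbhs_nbhs.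
  have itv (x : R) : exists a b : rat,
      (ratr a < x < ratr b) /\ [set y | ratr a < y < ratr b] `<=` ball x e.
    have [|a] := @rat_in_itvoo R (x - e) x; first by rewrite ltrBlDr ltrDl.
    have [|b] := @rat_in_itvoo R x (x + e); first by rewrite ltrDl.
    rewrite !in_itv/= => /andP[xb be] /andP[ea ax]; exists a, b.
    split; first by rewrite ax xb.
    move=> y /= /andP[ay yb].
    by rewrite /ball/= ltr_distlC (lt_trans ea ay) (lt_trans yb be).
  have [a [b [ab abe]]] := itv p.1; have [c [d [cd cde]]] := itv p.2.
  exists ((a, b), (c, d)) => //; case: asboolP => [_|]; first by split; rewrite /= in_itv.
  by case=> q [] /=; rewrite !in_itv/= => /abe q1 /cde q2; apply: eU; split.
apply: countable_bigcupT_measurable => [|i]; first exact: countableP.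
by case: asboolP => // _; apply: measurableX; exact: measurable_itv.
Qed.

Definition disk2 : set (R * R) := [set p | disk (p.1 +i* p.2)].

Lemma continuous_measurable2 (u : R * R -> R) :
  (forall p, disk2 p -> {for p, continuous u}) -> measurable_fun disk2 u.
Proof.
move=> cu; apply: (measurability _ (RGenOInfty.measurableE R)).
move=> _ [_ [x ->] <-]; apply: open_measurable2.
rewrite openE => p [Dp xp]; apply: filterI.
- have : {for p, continuous (fun p : R * R => normc (p.1 +i* p.2 : C))}.
    by apply: continuous_comp; [exact: cplx_continuous|exact: normc_continuous].
  by move/cvgr_lt; apply.
- move/cvgr_gt: (cu _ Dp) => /(_ x).
  move: xp; rewrite /= in_itv/= andbT => xp /(_ xp).
  by apply: filterS => q /=; rewrite in_itv/= andbT.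
Qed.

Lemma integral_dom d (T : measurableType d) (mu : {measure set T -> \bar R})
    (D : set T) (c a b : R) (F G H : T -> R) : measurable D ->
  0 <= c -> 0 <= a -> 0 <= b ->
  measurable_fun D F -> measurable_fun D G -> measurable_fun D H ->
  (forall x, D x -> 0 <= F x) -> (forall x, D x -> 0 <= G x) ->
  (forall x, D x -> 0 <= H x <= a * F x + b * G x) ->
  (c%:E * \int[mu]_(x in D) (H x)%:E <=
    a%:E * (c%:E * \int[mu]_(x in D) (F x)%:E) +
    b%:E * (c%:E * \int[mu]_(x in D) (G x)%:E))%E.
Proof.
move=> mD c0 a0 b0 mF mG mH F0 G0 H0.
rewrite muleCA [X in (_ + X)%E]muleCA -ge0_muleDr; last 2 first.
- by apply: mule_ge0; rewrite ?lee_fin//; apply: integral_ge0 => x /F0.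
- by apply: mule_ge0; rewrite ?lee_fin//; apply: integral_ge0 => x /G0.
apply: lee_wpmul2l; first by rewrite lee_fin.
rewrite -(ge0_integralZl_EFin mu mD _ _ a0)//; last exact/measurable_EFinP.
rewrite -(ge0_integralZl_EFin mu mD _ _ b0)//; last exact/measurable_EFinP.
rewrite -ge0_integralD//; last 4 first.
- by move=> x Dx; rewrite mule_ge0// lee_fin ?F0.
- by apply/measurable_EFinP; exact: measurable_funM.
- by move=> x Dx; rewrite mule_ge0// lee_fin ?G0.
- by apply/measurable_EFinP; exact: measurable_funM.
apply: ge0_le_integral => //.
- by move=> x /H0/andP[].
- exact/measurable_EFinP.
- by apply/measurable_EFinP; apply: measurable_funD; exact: measurable_funM.
- by move=> x /H0/andP[_]; rewrite -!EFinM -EFinD lee_fin.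
Qed.

Lemma normc_circle (r t : R) : 0 <= r -> normc (circle r t) = r.
Proof.
move=> r0; rewrite /normc /= !exprMn -mulrDr cos2Dsin2 mulr1 sqrtr_sqr.
by rewrite ger0_norm.
Qed.

Lemma disk_circle (r t : R) : 0 < r < 1 -> disk (circle r t).
Proof. by move=> /andP[r0 r1]; rewrite /disk /mkset normc_circle// ltW. Qed.

Lemma measurable_circle (r : R) f (D : set R) : 0 < r < 1 -> holomorphic f ->
  measurable_fun D (fun t => normc (f (circle r t)) ^+ 2).
Proof.
move=> r01 hf; apply: measurable_funTS.
apply: continuous_measurable_fun => t.
have ct : {for t, continuous (circle r : R -> C)}.
  apply: (@continuous_comp _ _ _ (fun t => (r * cos t, r * sin t))
    (fun p : R * R => p.1 +i* p.2 : C)); last exact: cplx_continuous.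
  apply: (@cvg_pair _ _ _ _ (nbhs (r * cos t)) (nbhs (r * sin t))) => /=;
    apply: cvgM; [exact: cvg_cst|exact: continuous_cos|
                  exact: cvg_cst|exact: continuous_sin].
have cf : {for t, continuous (fun t => normc (f (circle r t)))}.
  apply: (@continuous_comp _ _ _ (fun t => f (circle r t)) (@normc R)).
    apply: (@continuous_comp _ _ _ (circle r : R -> C) f); first exact: ct.
    by apply: holomorphic_continuous hf _; exact: disk_circle.
  exact: normc_continuous.
by rewrite /=; under eq_fun do rewrite expr2; exact: cvgM.
Qed.

Lemma hardy_dom (a b : R) f g h : 0 <= a -> 0 <= b ->
  holomorphic f -> holomorphic g -> holomorphic h ->
  (forall z, disk z ->
    normc (h z) ^+ 2 <= a * normc (f z) ^+ 2 + b * normc (g z) ^+ 2) ->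
  (hardy_sqnorm h <= a%:E * hardy_sqnorm f + b%:E * hardy_sqnorm g)%E.
Proof.
move=> a0 b0 hf hg hh fgh; apply: ge_ereal_sup => _ [r /= r01 <-].
apply: (@le_trans _ _ (a%:E * hardy_mean r f + b%:E * hardy_mean r g)%E).
  apply: integral_dom => //; do ?exact: measurable_circle.
  - by rewrite invr_ge0 mulr_ge0 ?pi_ge0.
  - by move=> t _; rewrite sqr_ge0.
  - by move=> t _; rewrite sqr_ge0.
  - move=> t _; by rewrite sqr_ge0 fgh//; exact: disk_circle.
by apply: leeD; (apply: lee_wpmul2l; [by rewrite lee_fin|]);
  apply: ereal_sup_ubound; exists r.
Qed.

Lemma bergman_dom (alpha a b : R) f g h : -1 < alpha -> 0 <= a -> 0 <= b ->
  holomorphic f -> holomorphic g -> holomorphic h ->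
  (forall z, disk z ->
    normc (h z) ^+ 2 <= a * normc (f z) ^+ 2 + b * normc (g z) ^+ 2) ->
  (bergman_sqnorm alpha h <=
    a%:E * bergman_sqnorm alpha f + b%:E * bergman_sqnorm alpha g)%E.
Proof.
move=> a1 a0 b0 hf hg hh fgh.
have md : measurable disk2.
  apply: open_measurable2; rewrite openE => p Dp.
  have : {for p, continuous (fun p : R * R => normc (p.1 +i* p.2 : C))}.
    by apply: continuous_comp; [exact: cplx_continuous|exact: normc_continuous].
  by move/cvgr_lt; apply.
have cn f' p : holomorphic f' -> disk2 p ->
    {for p, continuous (fun p => normc (f' (p.1 +i* p.2)))}.
  move=> hf' Dp.
  apply: (@continuous_comp _ _ _ (fun p : R * R => f' (p.1 +i* p.2)) (@normc R)).
    apply: (@continuous_comp _ _ _ (fun p : R * R => p.1 +i* p.2 : C) f').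
      exact: cplx_continuous.
    exact: holomorphic_continuous.
  exact: normc_continuous.
have mn f' : holomorphic f' ->
    measurable_fun disk2 (fun p => normc (f' (p.1 +i* p.2))).
  by move=> hf'; apply: continuous_measurable2 => p; exact: cn.
have m1 f' : holomorphic f' -> measurable_fun disk2 (fun p =>
    normc (f' (p.1 +i* p.2)) ^+ 2 *
      ((alpha + 1) * (1 - normc (p.1 +i* p.2) ^+ 2) `^ alpha)).
  move=> hf'; have hid : holomorphic (id : C -> C).
    by move=> z _; exact: derivable_id.
  apply: measurable_funM; first exact: (measurable_funX 2 (mn _ hf')).
  apply: measurable_funM; first exact: measurable_cst.
  apply: (@measurableT_comp _ _ _ _ _ _ (fun x : R => x `^ alpha) disk2
    (fun p => 1 - normc (p.1 +i* p.2) ^+ 2)); first exact: measurable_powR.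
  apply: measurable_funB; first exact: measurable_cst.
  exact: (measurable_funX 2 (mn _ hid)).
have w0 p : 0 <= (alpha + 1) * (1 - normc (p.1 +i* p.2) ^+ 2) `^ alpha.
  by rewrite mulr_ge0 ?powR_ge0//; lra.
apply: integral_dom => //; do ?exact: m1.
- by rewrite invr_ge0 pi_ge0.
- by move=> p _; rewrite mulr_ge0 ?sqr_ge0.
- by move=> p _; rewrite mulr_ge0 ?sqr_ge0.
- move=> p Dp; apply/andP; split; first by rewrite mulr_ge0 ?sqr_ge0.
  by rewrite (mulrA a) (mulrA b) -mulrDl; apply: ler_wpM2r; [exact: w0|exact: fgh].
Qed.

Definition hardy : holo_sqnorm R := HoloSqNorm hardy_dom.

Definition bergman (alpha : R) (halpha : -1 < alpha) : holo_sqnorm R :=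
  HoloSqNorm (fun a b f g h => @bergman_dom alpha a b f g h halpha).

End Domination.

Section HilbertModule.
Variable R : realType.
Local Notation C := R[i].

(* The data of a Hilbert module over C[z] to which isomorphism refers.  That
   [hm_norm] comes from a complete inner product and that the action is a
   bounded module action is true of the modules below (for a quotient by a
   closed submodule), but not recorded. *)
Record hilbert_module := HilbertModule {
  hm_space :> lmodType C;
  hm_norm : hm_space -> R;
  hm_act : {poly C} -> hm_space -> hm_space }.

(* The inner product, linear in the first argument, is recovered from the
   norm by polarization. *)
Definition hm_ip (M : hilbert_module) (x y : M) : C :=
  4%:R^-1 * \sum_(k < 4) 'i%C ^+ k * (hm_norm (x + 'i%C ^+ k *: y) ^+ 2)%:C.

Definition unitary (M N : hilbert_module) (X : {linear M -> N}) :=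
  (forall y, exists x, X x = y) /\
  (forall x y, hm_ip (X x) (X y) = hm_ip x y).

Definition isomorphic (M N : hilbert_module) :=
  exists X : {linear M -> N}, unitary X /\
    forall p f, X (hm_act p f) = hm_act p (X f).

End HilbertModule.

Section FunctionModule.
Variable R : realType.
Local Notation C := R[i].
Variable N : holo_sqnorm R.

(* A holomorphic function on the disk is represented by its extension by
   zero. *)
Definition in_hfun : {pred C -> C} := fun f =>
  `[< [/\ holomorphic f, forall z, ~ disk z -> f z = 0 & (N f < +oo)%E] >].

Lemma holomorphicZD (a : C) (f g : C -> C) :
  holomorphic f -> holomorphic g -> holomorphic (a *: f + g).
Proof.
by move=> hf hg z Dz; apply: derivableD; [apply: derivableZ; exact: hf|exact: hg].
Qed.

Lemma holomorphicM (f g : C -> C) :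
  holomorphic f -> holomorphic g -> holomorphic (fun z => f z * g z).
Proof.
by move=> hf hg z Dz; apply: derivableM; [exact: hf|exact: hg].
Qed.

Lemma holomorphic0 : holomorphic (0 : C -> C).
Proof. by move=> z _; exact: derivable_cst. Qed.

Lemma in_hfun_submod : submod_closed in_hfun.
Proof.
split=> [|a f g /asboolP[hf f0 Nf] /asboolP[hg g0 Ng]]; apply/asboolP; split.
- exact: holomorphic0.
- by [].
- apply: (@le_lt_trans _ _ ((0:R)%:E * N 0%R + (0:R)%:E * N 0%R)%E); last first.
    by rewrite !mul0e adde0.
  apply: sqnorm_dom => //; do ?exact: holomorphic0.
  by move=> z _; rewrite normc0 expr0n !mulr0 addr0.
- exact: holomorphicZD.
- move=> z Dz; rewrite -[_ z]/(a * f z + g z).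
  by rewrite f0// g0// mulr0 addr0.
- apply: (@le_lt_trans _ _ ((2 * normc a ^+ 2)%:E * N f + (2:R)%:E * N g)%E).
    apply: (@sqnorm_dom R N _ _ f g _ _ _ hf hg (holomorphicZD hf hg)).
    - by rewrite mulr_ge0 ?sqr_ge0.
    - by rewrite ler0n.
    move=> z _; rewrite -[(_ + _) z]/(a * f z + g z).
    have := le_normcD (a * f z) (g z); rewrite normcM.
    have := normc_ge0 (a * f z + g z).
    move: (normc (a * f z + g z)) (normc a) (normc (f z)) (normc (g z)).
    move=> s u v w s0 suv.
    apply: (@le_trans _ _ ((u * v + w) ^+ 2)).
      by rewrite ler_pXn2r ?nnegrE// (le_trans s0).
    by have := sqr_ge0 (u * v - w); nra.
  by apply: lte_add_pinfty; apply: lte_mul_pinfty;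
    rewrite ?lee_fin ?mulr_ge0 ?normc_ge0 ?ler0n//.
Qed.

HB.instance Definition _ :=
  GRing.isSubmodClosed.Build C (C -> C) in_hfun in_hfun_submod.

Record hfun := HFun { hfun_val :> C -> C; hfun_valP : hfun_val \in in_hfun }.

HB.instance Definition _ := [isSub for hfun_val].
HB.instance Definition _ := [Choice of hfun by <:].
HB.instance Definition _ := [SubChoice_isSubLmodule of hfun by <:].

Lemma poly_bounded (p : {poly C}) : bounded_on_disk (fun z => p.[z]).
Proof.
elim/poly_ind: p => [|p c [M pM]].
  by exists 0 => z _; rewrite horner0 normc0.
exists (M + normc c) => z Dz; rewrite hornerMXaddC.
apply: (le_trans (le_normcD _ _)); rewrite lerD2r normcM.
apply: le_trans (pM z Dz); rewrite ler_piMr ?normc_ge0//.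
exact: ltW.
Qed.

Lemma holomorphic_poly (p : {poly C}) : holomorphic (fun z => p.[z]).
Proof.
elim/poly_ind: p => [|p c IH].
  have -> : (fun z => (0 : {poly C}).[z]) = (0 : C -> C).
    by apply/funext => z; rewrite horner0.
  exact: holomorphic0.
have -> : (fun z => (p * 'X + c%:P).[z]) = (fun z => p.[z] * z) + cst c.
  by apply/funext => z; rewrite hornerMXaddC.
move=> z Dz; apply: derivableD; last exact: derivable_cst.
have hid : holomorphic (id : C -> C) by move=> w _; exact: derivable_id.
exact: (holomorphicM IH hid Dz).
Qed.

Lemma poly_mul_in_hfun (p : {poly C}) (f : hfun) :
  (fun z => p.[z] * f z) \in in_hfun.
Proof.
have /asboolP[hf f0 Nf] := hfun_valP f.
have hp := @holomorphic_poly p.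
have [M pM] := poly_bounded p.
apply/asboolP; split; first exact: (holomorphicM hp hf).
  by move=> z Dz; rewrite f0 ?mulr0.
apply: (@le_lt_trans _ _ ((M ^+ 2)%:E * N f + (0:R)%:E * N f)%E).
  apply: (@sqnorm_dom R N _ _ f f _ _ _ hf hf (holomorphicM hp hf)).
  - exact: sqr_ge0.
  - exact: lexx.
  move=> z /pM pzM; rewrite mul0r addr0 normcM exprMn ler_wpM2r ?sqr_ge0//.
  by rewrite ler_pXn2r ?nnegrE ?normc_ge0// (le_trans (normc_ge0 _) pzM).
by rewrite mul0e adde0; apply: lte_mul_pinfty; rewrite ?lee_fin ?sqr_ge0//.
Qed.

Definition hfun_module : hilbert_module R :=
  @HilbertModule R hfun (fun f => Num.sqrt (fine (N f)))
    (fun p f => HFun (poly_mul_in_hfun p f)).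

End FunctionModule.

Section Constructions.
Variable R : realType.
Local Notation C := R[i].

(* [M] tensor C^2, where [(f, g)] stands for f (x) e1 + g (x) e2. *)
Definition tensorC2 (M : hilbert_module R) : hilbert_module R :=
  @HilbertModule R (M * M)%type
    (fun F => Num.sqrt (hm_norm F.1 ^+ 2 + hm_norm F.2 ^+ 2))
    (fun p F => (hm_act p F.1, hm_act p F.2)).

Section LmodQuotient.
Variables (V : lmodType C) (W : submodClosed V).

Definition zmod_of_submod : {pred V} := W.

Lemma zmod_of_submod_closed : zmod_closed zmod_of_submod.
Proof. exact: GRing.submod_closedB (submodClosedP W). Qed.

HB.instance Definition _ :=
  GRing.isZmodClosed.Build V zmod_of_submod zmod_of_submod_closed.

Definition lmod_quot := Quotient.quot zmod_of_submod.

HB.instance Definition _ := GRing.Zmodule.on lmod_quot.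

Definition lmod_pi (x : V) : lmod_quot := \pi_(Quotient.quot zmod_of_submod) x.

Lemma lmod_piE x y : (lmod_pi x == lmod_pi y) = (x - y \in W).
Proof. by rewrite [RHS](Quotient.idealrBE zmod_of_submod). Qed.

Lemma lmod_piD : {morph lmod_pi : x y / x + y}.
Proof. by move=> x y; exact: (raddfD (\pi_(Quotient.quot zmod_of_submod))). Qed.

Definition lmod_quot_scale (a : C) (x : lmod_quot) : lmod_quot :=
  lmod_pi (a *: repr x).

Lemma lmod_quot_scaleE a x : lmod_quot_scale a (lmod_pi x) = lmod_pi (a *: x).
Proof.
apply/eqP; rewrite lmod_piE -scalerBr rpredZ//.
by rewrite -lmod_piE /lmod_pi reprK.
Qed.

Lemma lmod_quot_scaleA a b x :
  lmod_quot_scale a (lmod_quot_scale b x) = lmod_quot_scale (a * b) x.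
Proof.
rewrite -[x]reprK -/(lmod_pi _) !lmod_quot_scaleE scalerA//.
Qed.

Lemma lmod_quot_scale1 : left_id 1 lmod_quot_scale.
Proof. by move=> x; rewrite /lmod_quot_scale scale1r /lmod_pi reprK. Qed.

Lemma lmod_quot_scaleDr : right_distributive lmod_quot_scale +%R.
Proof.
move=> a x y; rewrite -[x]reprK -[y]reprK -!/(lmod_pi _) -lmod_piD.
by rewrite !lmod_quot_scaleE scalerDr lmod_piD.
Qed.

Lemma lmod_quot_scaleDl x : {morph lmod_quot_scale^~ x : a b / a + b}.
Proof. by move=> a b; rewrite /lmod_quot_scale scalerDl lmod_piD. Qed.

HB.instance Definition _ := GRing.Zmodule_isLmodule.Build C lmod_quot
  lmod_quot_scaleA lmod_quot_scale1 lmod_quot_scaleDr lmod_quot_scaleDl.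

End LmodQuotient.

Definition quotient_module (M : hilbert_module R) (W : submodClosed M) :
    hilbert_module R :=
  @HilbertModule R (lmod_quot W)
    (fun x => inf [set hm_norm F | F in [set F : M | lmod_pi W F = x]])
    (fun p x => lmod_pi W (hm_act p (repr x))).

Section Range.
Variables (N : holo_sqnorm R) (theta1 theta2 : C -> C).
Local Notation H := (hfun_module N).

Definition ran_mul : {pred tensorC2 H} := fun F =>
  `[< exists f : hfun N,
        (F.1 : hfun N) = (fun z => theta1 z * f z) :> (C -> C) /\
        (F.2 : hfun N) = (fun z => theta2 z * f z) :> (C -> C) >].

Lemma hfunZDE (a : C) (f g : hfun N) z : (a *: f + g) z = a * f z + g z.
Proof. by []. Qed.

Lemma ran_mul_submod : submod_closed ran_mul.
Proof.
split=> [|a [F1 F2] [G1 G2] /asboolP[f [/= Ff1 Ff2]] /asboolP[g [/= Gg1 Gg2]]];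
  apply/asboolP.
  by exists 0; split; apply/funext => z /=; rewrite mulr0.
exists (a *: f + g); split; apply/funext => z.
- by rewrite (hfunZDE a F1 G1) Ff1 Gg1 hfunZDE mulrDr mulrCA.
- by rewrite (hfunZDE a F2 G2) Ff2 Gg2 hfunZDE mulrDr mulrCA.
Qed.

HB.instance Definition _ :=
  GRing.isSubmodClosed.Build C (tensorC2 H) ran_mul ran_mul_submod.

Definition quotient_by_range : hilbert_module R := quotient_module ran_mul.

Lemma quotient_by_range_act (p : {poly C}) (F : tensorC2 H) :
  hm_act p (lmod_pi ran_mul F : quotient_by_range) =
  lmod_pi ran_mul (hm_act p F).
Proof.
apply/eqP; rewrite lmod_piE; set G := repr _.
have : G - F \in ran_mul by rewrite -lmod_piE /lmod_pi reprK.
case: F G => [F1 F2] [G1 G2] /asboolP[f [/= GF1 GF2]]; apply/asboolP.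
exists (HFun (poly_mul_in_hfun p f)); split; apply/funext => z /=.
- have GFz : G1 z - F1 z = theta1 z * f z by rewrite -[RHS](congr1 (@^~ z) GF1).
  by rewrite mulrCA -GFz mulrBr.
- have GFz : G2 z - F2 z = theta2 z * f z by rewrite -[RHS](congr1 (@^~ z) GF2).
  by rewrite mulrCA -GFz mulrBr.
Qed.

End Range.
End Constructions.

(* Main.v *)
(* Multiplication by z^n tends strongly to 0 on the quotient of A^2_alpha,
   because it does so on A^2_alpha by dominated convergence and the quotient
   norm is at most the norm of a representative.  On the quotient of H^2 it
   does not: the map F |-> theta1 F_2 - theta2 F_1 kills the range of M_Theta,
   hence bounds the quotient norm from below by a multiple of the H^2 norm,
   and it sends z^n e_2 and z^n e_1 to z^n theta1 and - z^n theta2, whose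
   squared norms add up to at least eps ||z^n||^2 by the corona condition.  A
   unitary module map would intertwine the two behaviours. *)
Require Import Defs.
From mathcomp Require Import all_boot all_order all_algebra.
From mathcomp Require Import all_classical all_reals all_analysis.
From mathcomp Require Import complex measurable_realfun ring lra.

Set Implicit Arguments.
Unset Strict Implicit.
Unset Printing Implicit Defensive.

Import Order.TTheory GRing.Theory Num.Theory.
Import numFieldNormedType.Exports.
Import Normc.

Local Open Scope classical_set_scope.
Local Open Scope ring_scope.
Local Open Scope complex_scope.

(** * Norms under unitaries and on quotients *)

Section Quotients.
Variable R : realType.
Local Notation C := R[i].

(* The real part of the polarized [hm_ip x x] is ||2x||^2 / 4, so homogeneity
   of the norm is not needed. *)
Lemma unitary_norm (M N : hilbert_module R) (X : {linear M -> N}) :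
  hm_norm (0 : M) = 0 -> hm_norm (0 : N) = 0 ->
  (forall x : M, 0 <= hm_norm x) -> (forall x : N, 0 <= hm_norm x) ->
  unitary X -> forall x, hm_norm (X x) = hm_norm x.
Proof.
move=> M0 N0 M_ge0 N_ge0 [_ ipX].
have Re_ip (L : hilbert_module R) (x : L) : hm_norm (0 : L) = 0 ->
    complex.Re (hm_ip x x) = 4^-1 * hm_norm (x + x) ^+ 2.
  (* The terms k = 1 and k = 3 are purely imaginary and k = 2 carries the norm of [x - x], so only k
     = 0 has a nonzero real part. *)
  move=> L0; rewrite /hm_ip !big_ord_recl big_ord0 /= /bump /=.
  rewrite !expr0 !scale1r expr1 !exprS !expr0 !mulr1 !mulrA.
  rewrite -!expr2 sqr_i scaleN1r subrr L0 expr0n /=.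
  by field.
move=> x; pose h := 2^-1 *: x.
have hh : h + h = x by rewrite -scalerDl -div1r -splitr scale1r.
have : hm_norm (X x) ^+ 2 = hm_norm x ^+ 2.
  rewrite -[in LHS]hh linearD -[in RHS]hh.
  apply: (@mulfI _ 4^-1); first by rewrite invr_neq0 ?pnatr_eq0.
  by rewrite -!Re_ip// ipX.
by move/eqP; rewrite eqrXn2// => /eqP.
Qed.

(** Nonnegativity of the norm bounds the set of norms of representatives from below; without such a
    bound [inf] would be a default value. *)
Lemma quotient_norm_le (M : hilbert_module R) (W : submodClosed M) (F : M) :
  (forall G : M, 0 <= hm_norm G) ->
  hm_norm (lmod_pi W F : quotient_module W) <= hm_norm F.
Proof.
move=> M_ge0; apply: ge_inf; last by exists F.
by exists 0 => _ [G _ <-].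
Qed.

Lemma le_quotient_norm (M : hilbert_module R) (W : submodClosed M) (F : M) c :
  (forall G : M, lmod_pi W G = lmod_pi W F -> c <= hm_norm G) ->
  c <= hm_norm (lmod_pi W F : quotient_module W).
Proof.
move=> cG; apply: lb_le_inf; first by exists (hm_norm F), F.
by move=> _ [G GF <-]; exact: cG.
Qed.

Lemma quotient_norm_ge0 (M : hilbert_module R) (W : submodClosed M)
    (x : quotient_module W) :
  (forall G : M, 0 <= hm_norm G) -> 0 <= hm_norm x.
Proof. by move=> M_ge0; rewrite -[x]reprK; exact: le_quotient_norm. Qed.

End Quotients.

(** * The determinant with Theta and its bound on the quotient *)

Section CrossProduct.
Variables (R : realType) (N : holo_sqnorm R).
Local Notation C := R[i].
Local Notation H := (hfun_module N).
(* [holo_sqnorm] itself does not exclude the value -oo. *)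
Hypothesis N_ge0 : forall f, (0 <= N f)%E.

Lemma hfun_holomorphic (f : hfun N) : holomorphic f.
Proof. by have /asboolP[] := hfun_valP f. Qed.

Lemma sqnorm_fin (f : hfun N) : N f \is a fin_num.
Proof. by have /asboolP[_ _] := hfun_valP f; rewrite ge0_fin_numE. Qed.

(** Domination with both coefficients zero gives [N 0 <= 0], because [0 * N 0] is 0 even when [N 0]
    is infinite. *)
Lemma sqnorm0 : N 0%R = 0%E.
Proof.
apply/eqP; rewrite eq_le N_ge0 andbT.
rewrite (_ : 0%E = ((0:R)%:E * N 0%R + (0:R)%:E * N 0%R)%E); last first.
  by rewrite !mul0e adde0.
apply: sqnorm_dom => //; do ?exact: holomorphic0.
by move=> z _; rewrite normc0 expr0n !mulr0 addr0.
Qed.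

Lemma tensorC2_norm_ge0 (M : hilbert_module R) (F : tensorC2 M) :
  0 <= hm_norm F.
Proof. exact: sqrtr_ge0. Qed.

Lemma tensorC2_sqnormE (F : tensorC2 H) :
  ((hm_norm F ^+ 2)%:E = N (F.1 : hfun N) + N (F.2 : hfun N))%E.
Proof.
have N1 := fine_ge0 (N_ge0 (F.1 : hfun N)).
have N2 := fine_ge0 (N_ge0 (F.2 : hfun N)).
rewrite /= !sqr_sqrtr ?addr_ge0 ?sqr_ge0// EFinD.
by rewrite !fineK// sqnorm_fin.
Qed.

Lemma quotient_norm0 theta1 theta2 :
  hm_norm (0 : quotient_by_range N theta1 theta2) = 0.
Proof.
apply/eqP; rewrite eq_le quotient_norm_ge0 ?andbT; last exact: tensorC2_norm_ge0.
have -> : (0 : quotient_by_range N theta1 theta2) = lmod_pi _ 0.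
  by apply: (addrI (lmod_pi _ 0)); rewrite -lmod_piD !addr0.
apply: le_trans (@quotient_norm_le _ _ _ _ _) _; first exact: tensorC2_norm_ge0.
by rewrite /= sqnorm0 /= sqrtr0 expr0n /= addr0 sqrtr0.
Qed.

(** The determinant of the pair Theta, F. As a bare function it needs no proof of membership in
    [hfun N]. *)
Definition cross (theta1 theta2 : C -> C) (F : tensorC2 H) : C -> C :=
  fun z => theta1 z * (F.2 : hfun N) z - theta2 z * (F.1 : hfun N) z.

Lemma holomorphic_cross theta1 theta2 F :
  holomorphic theta1 -> holomorphic theta2 -> holomorphic (cross theta1 theta2 F).
Proof.
move=> h1 h2 z Dz; apply: derivableB.
  exact: (holomorphicM h1 (@hfun_holomorphic _)).
exact: (holomorphicM h2 (@hfun_holomorphic _)).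
Qed.

(** Two representatives differ by some Theta f, whose determinant with Theta vanishes; thus [cross]
    descends to the quotient. *)
Lemma cross_quotient (theta1 theta2 : C -> C) (F G : tensorC2 H) :
  lmod_pi (ran_mul theta1 theta2) G = lmod_pi (ran_mul theta1 theta2) F ->
  cross theta1 theta2 G = cross theta1 theta2 F.
Proof.
move/eqP; rewrite lmod_piE.
case: F G => [F1 F2] [G1 G2] /asboolP[f [/= GF1 GF2]]; apply/funext => z.
have GF1z : G1 z - F1 z = theta1 z * f z.
  by rewrite -[RHS](congr1 (@^~ z) GF1).
have GF2z : G2 z - F2 z = theta2 z * f z.
  by rewrite -[RHS](congr1 (@^~ z) GF2).
change (theta1 z * G2 z - theta2 z * G1 z = theta1 z * F2 z - theta2 z * F1 z).
move: GF1z GF2z; move: (F1 z) (F2 z) (G1 z) (G2 z) (theta1 z) (theta2 z) (f z).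
by move=> f1 f2 g1 g2 t1 t2 c /(canRL (subrK _)) -> /(canRL (subrK _)) ->; ring.
Qed.

(** The bound holds for every representative, and by [cross_quotient] its left side is the same for
    all of them, so the infimum can be taken on the right. The constant comes from (Ma + Mb)^2 <= 2
    M^2 (a^2 + b^2). *)
Lemma sqnorm_cross_le theta1 theta2 (M : R) (F : tensorC2 H) :
  holomorphic theta1 -> holomorphic theta2 -> 0 < M ->
  (forall z, disk z -> normc (theta1 z) <= M) ->
  (forall z, disk z -> normc (theta2 z) <= M) ->
  (N (cross theta1 theta2 F) <=
   (2 * M ^+ 2 * hm_norm (lmod_pi (ran_mul theta1 theta2) F
      : quotient_by_range N theta1 theta2) ^+ 2)%:E)%E.
Proof.
move=> h1 h2 M0 M1 M2; have K0 : 0 < 2 * M ^+ 2 by rewrite mulr_gt0// exprn_gt0.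
have NG (G : tensorC2 H) :
    (N (cross theta1 theta2 G) <= (2 * M ^+ 2 * hm_norm G ^+ 2)%:E)%E.
  rewrite EFinM tensorC2_sqnormE ge0_muleDr// [leRHS]addeC.
  apply: (@sqnorm_dom R N _ _ (G.2 : hfun N) (G.1 : hfun N) _ (ltW K0) (ltW K0)).
  - exact: hfun_holomorphic.
  - exact: hfun_holomorphic.
  - exact: holomorphic_cross.
  move=> z Dz; rewrite /cross.
  have := le_normcD (theta1 z * (G.2 : hfun N) z) (- (theta2 z * (G.1 : hfun N) z)).
  rewrite normcN !normcM => le12.
  have {}le12 := le_trans le12 (lerD (ler_wpM2r (normc_ge0 _) (M1 z Dz))
    (ler_wpM2r (normc_ge0 _) (M2 z Dz))).
  apply: (@le_trans _ _
    ((M * normc ((G.2 : hfun N) z) + M * normc ((G.1 : hfun N) z)) ^+ 2)).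
    by rewrite ler_pXn2r ?nnegrE ?normc_ge0// (le_trans (normc_ge0 _) le12).
  move: (normc _) (normc _) => a b; rewrite -subr_ge0.
  rewrite (_ : _ - _ = (M * (a - b)) ^+ 2) ?sqr_ge0//; ring.
set c := fine (N (cross theta1 theta2 F)).
have cE : N (cross theta1 theta2 F) = c%:E.
  by rewrite fineK// ge0_fin_numE// (le_lt_trans (NG F))// ltry.
have c0 : 0 <= c by exact: fine_ge0.
rewrite cE lee_fin mulrC -ler_pdivrMr//.
have c0' : 0 <= c / (2 * M ^+ 2) by rewrite divr_ge0// ltW.
(* The quotient norm is an infimum of norms, not of squares; hence the passage to square roots
   before comparing with each [G]. *)
rewrite -[leLHS]sqr_sqrtr// ler_pXn2r ?nnegrE ?sqrtr_ge0//; last first.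
  by apply: quotient_norm_ge0 => G; exact: tensorC2_norm_ge0.
apply: le_quotient_norm => G /cross_quotient GF.
rewrite -(@ler_pXn2r _ 2)// ?nnegrE ?sqrtr_ge0// ?tensorC2_norm_ge0//.
by rewrite sqr_sqrtr// ler_pdivrMr// mulrC -lee_fin -cE -GF.
Qed.

End CrossProduct.

(** * Monomials in the Hardy space *)

Section Hardy.
Variable R : realType.
Local Notation C := R[i].
Local Notation H := (hfun_module (hardy R)).

Lemma hardy_sqnorm_ge0 (f : C -> C) : (0 <= hardy R f)%E.
Proof.
(* Any radius in (0, 1) would do; one is needed because an empty supremum is -oo. *)
apply: (@le_trans _ _ (hardy_mean 2^-1 f)).
  apply: mule_ge0; last by apply: integral_ge0 => t _; rewrite lee_fin sqr_ge0.
  by rewrite lee_fin invr_ge0 mulr_ge0// pi_ge0.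
by apply: ereal_sup_ubound; exists 2^-1 => //=; lra.
Qed.

Lemma hardy_mean_cst (r k : R) (f : C -> C) :
  (forall t, normc (f (circle r t)) ^+ 2 = k) -> hardy_mean r f = k%:E.
Proof.
move=> fk; rewrite /hardy_mean; under eq_integral do rewrite fk.
have pi2 : 0 < 2 * pi :> R by rewrite mulr_gt0 ?pi_gt0.
rewrite integral_cst//= lebesgue_measure_itv/= lte_fin pi2 sube0.
by rewrite -!EFinM mulrCA mulVf ?mulr1// gt_eqF.
Qed.

Lemma nbhs_disk (z : C) : disk z -> nbhs z (@disk R).
Proof. by move/cvgr_lt: (@normc_continuous R z); apply. Qed.

(** Cut off outside the disk because [in_hfun] demands vanishing there. *)
Definition disk_one : C -> C := fun z => if `[< disk z >] then 1 else 0.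

Lemma disk_oneE (z : C) : disk z -> disk_one z = 1.
Proof. by rewrite /disk_one; case: asboolP. Qed.

Lemma disk_one_in_hfun : disk_one \in in_hfun (hardy R).
Proof.
apply/asboolP; split.
- move=> z Dz; apply: (near_eq_derivable (f := cst (1 : C)) _ (derivable_cst _ _ _)).
  by apply: filterS (nbhs_disk Dz) => w /disk_oneE.
- by move=> z; rewrite /disk_one; case: asboolP.
- apply: (@le_lt_trans _ _ (1:R)%:E); last exact: ltry.
  apply: ge_ereal_sup => _ [r /= r01 <-]; rewrite (@hardy_mean_cst _ 1)// => t.
  by rewrite disk_oneE ?normc1 ?expr1n//; exact: disk_circle.
Qed.

Definition hardy_one : hfun (hardy R) := HFun disk_one_in_hfun.

Lemma normcX (z : C) n : normc (z ^+ n) = normc z ^+ n.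
Proof. by elim: n => [|n IH]; rewrite ?expr0 ?normc1// !exprS normcM IH. Qed.

Lemma hardy_monomial_ge n :
  ((expR (-1))%:E <=
   hardy R (hm_act 'X^n (hardy_one : H) : hfun (hardy R)))%E.
Proof.
(* Any r with r^(2n) bounded below independently of n will do; here
   r^(2n) >= e^-1. *)
pose r : R := expR (- (n.*2.+1)%:R^-1).
have r01 : 0 < r < 1 by rewrite expR_gt0 expR_lt1 oppr_lt0 invr_gt0 ltr0n.
have rt t : normc ((hm_act 'X^n (hardy_one : H) : hfun (hardy R)) (circle r t)) ^+ 2
    = r ^+ n.*2.
  rewrite /= hornerXn disk_oneE ?mulr1; last exact: disk_circle.
  by rewrite normcX normc_circle ?expR_ge0// -exprM muln2.
apply: (@le_trans _ _ (r ^+ n.*2)%:E); last first.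
  by rewrite -(hardy_mean_cst rt); apply: ereal_sup_ubound; exists r.
(* The exponent is -2n / (2n + 1) >= -1; the odd denominator stays positive at n = 0. *)
rewrite lee_fin -expRM_natl ler_expR mulrN lerN2 ler_pdivrMr// mul1r.
by rewrite ler_nat.
Qed.

End Hardy.

(** * Decay of shifts in the Bergman space and its quotient *)

Section Bergman.
Variables (R : realType) (alpha : R) (halpha : -1 < alpha).
Local Notation C := R[i].
Local Notation A := (hfun_module (bergman halpha)).

Let w (p : R * R) : R := (alpha + 1) * (1 - normc (p.1 +i* p.2) ^+ 2) `^ alpha.

Let w_ge0 p : 0 <= w p.
Proof. by rewrite mulr_ge0 ?powR_ge0//; move: halpha; lra. Qed.

Lemma bergman_sqnorm_ge0 (f : C -> C) : (0 <= bergman halpha f)%E.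
Proof.
apply: mule_ge0; first by rewrite lee_fin invr_ge0 pi_ge0.
by apply: integral_ge0 => p _; rewrite lee_fin mulr_ge0 ?sqr_ge0//; exact: w_ge0.
Qed.

Lemma measurable_disk2 : measurable (@disk2 R).
Proof.
apply: open_measurable2; rewrite openE => p Dp.
have : {for p, continuous (fun p : R * R => normc (p.1 +i* p.2 : C))}.
  by apply: continuous_comp; [exact: cplx_continuous|exact: normc_continuous].
by move/cvgr_lt; apply.
Qed.

Lemma measurable_normc_disk2 (f : C -> C) : holomorphic f ->
  measurable_fun (@disk2 R) (fun p => normc (f (p.1 +i* p.2))).
Proof.
move=> hf; apply: continuous_measurable2 => p Dp.
apply: (@continuous_comp _ _ _ (fun p : R * R => f (p.1 +i* p.2)) (@normc R)).
  apply: (@continuous_comp _ _ _ (fun p : R * R => p.1 +i* p.2 : C) f).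
    exact: cplx_continuous.
  exact: holomorphic_continuous.
exact: normc_continuous.
Qed.

Lemma measurable_bergman_density (f : C -> C) : holomorphic f ->
  measurable_fun (@disk2 R) (fun p => (normc (f (p.1 +i* p.2)) ^+ 2 * w p)%:E).
Proof.
move=> hf; apply/measurable_EFinP; apply: measurable_funM.
  exact: (measurable_funX 2 (measurable_normc_disk2 hf)).
apply: measurable_funM; first exact: measurable_cst.
apply: (@measurableT_comp _ _ _ _ _ _ (fun x : R => x `^ alpha) (@disk2 R)
  (fun p => 1 - normc (p.1 +i* p.2) ^+ 2)); first exact: measurable_powR.
apply: measurable_funB; first exact: measurable_cst.
apply: (measurable_funX 2 (@measurable_normc_disk2 id _)).
by move=> z _; exact: derivable_id.
Qed.

(** The density of z^n g is |z|^(2n) times that of g: it tends to 0 at each point of the open disk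
    and is dominated by the density of g, which is integrable. *)
Lemma bergman_shift_cvg0 (g : hfun (bergman halpha)) :
  bergman halpha (hm_act 'X^n (g : A) : hfun (bergman halpha))
    @[n --> \oo] --> 0%E.
Proof.
pose G (n : nat) (p : R * R) : \bar R :=
  (normc (('X^n : {poly C}).[p.1 +i* p.2] * g (p.1 +i* p.2)) ^+ 2 * w p)%:E.
have /asboolP[hg _ Ng] := hfun_valP g.
have hXg n : holomorphic (fun z => ('X^n : {poly C}).[z] * g z).
  by apply: (holomorphicM _ hg); exact: holomorphic_poly.
have GE n p : G n p = ((normc (p.1 +i* p.2) ^+ 2) ^+ n *
    (normc (g (p.1 +i* p.2)) ^+ 2 * w p))%:E.
  by rewrite /G hornerXn normcM normcX exprMn mulrA exprAC.
have gw_ge0 p : 0 <= normc (g (p.1 +i* p.2)) ^+ 2 * w p.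
  by rewrite mulr_ge0 ?sqr_ge0.
have [] := @dominated_convergence _ _ R
  (lebesgue_measure \x lebesgue_measure)%E (@disk2 R) measurable_disk2 G (cst 0%E)
  (fun p => (normc (g (p.1 +i* p.2)) ^+ 2 * w p)%:E).
- by move=> n; exact: (measurable_bergman_density (hXg n)).
- exact: measurable_cst.
- apply/aeW => p Dp; under eq_fun do rewrite GE.
  apply: cvg_EFin; first exact: nearW.
  rewrite -[X in _ --> X](mul0r (normc (g (p.1 +i* p.2)) ^+ 2 * w p)).
  apply: cvgMl; apply: cvg_expr.
  by rewrite ger0_norm ?sqr_ge0// expr_lt1// normc_ge0.
- apply/integrableP; split; first exact: measurable_bergman_density.
  under eq_integral do rewrite gee0_abs ?lee_fin//.
  set I := (\int[_]_(_ in _) _)%E.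
  (* Since 1/pi is positive, an infinite [I] would make the squared norm of [g] infinite. *)
  have {}Ng : ((pi^-1)%:E * I < +oo)%E by exact: Ng.
  rewrite ltNge leye_eq; apply: contraTN Ng => /eqP ->.
  by rewrite gt0_muley ?lte_fin ?invr_gt0 ?pi_gt0.
- apply/aeW => p n Dp; rewrite GE gee0_abs lee_fin; last first.
    by apply: mulr_ge0; rewrite // exprn_ge0// sqr_ge0.
  rewrite ler_piMl//; apply: exprn_ile1; first exact: sqr_ge0.
  by apply: exprn_ile1; [exact: normc_ge0|exact: ltW].
move=> _ _; rewrite integral0 => /(cvgeZl (y := (pi^-1)%:E)).
by rewrite mule0; apply.
Qed.

Lemma bergman_quotient_shift_cvg0 phi1 phi2
    (y : quotient_by_range (bergman halpha) phi1 phi2) :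
  hm_norm (hm_act 'X^n y) ^+ 2 @[n --> \oo] --> 0.
Proof.
(* The quotient action is defined through [repr], so the class of z^n F is z^n y by definition. *)
pose F : tensorC2 A := repr y.
have cF : (hm_norm (hm_act 'X^n F) ^+ 2)%:E @[n --> \oo] --> 0%E.
  under eq_fun do rewrite (tensorC2_sqnormE bergman_sqnorm_ge0).
  rewrite -(adde0 0%E).
  apply: cvgeD => //; exact: bergman_shift_cvg0.
have y_ge0 n : 0 <= hm_norm (hm_act 'X^n y).
  by apply: quotient_norm_ge0 => G; exact: sqrtr_ge0.
have le_yF n : hm_norm (hm_act 'X^n y) <= hm_norm (hm_act 'X^n F).
  apply: (@quotient_norm_le _ _ (ran_mul phi1 phi2) (hm_act 'X^n F)) => G.
  exact: sqrtr_ge0.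
apply: (@squeeze_cvgr _ _ _ _ (cst 0) (fun n => hm_norm (hm_act 'X^n F) ^+ 2)).
- apply: nearW => n; rewrite sqr_ge0 /=.
  by rewrite lerXn2r ?nnegrE ?y_ge0 ?le_yF// sqrtr_ge0.
- exact: cvg_cst.
- by have /fine_cvgP[] := cF.
Qed.

End Bergman.

(** * Lower bound for shifts in the Hardy quotient *)

Section HardyQuotient.
Variable R : realType.
Local Notation C := R[i].
Local Notation H := (hfun_module (hardy R)).

Variables theta1 theta2 : C -> C.
Local Notation Q := (quotient_by_range (hardy R) theta1 theta2).
Local Notation class F := (lmod_pi (ran_mul theta1 theta2) (F : tensorC2 H) : Q).

(** The factor [eps^-1] comes from the corona condition, and [2 * M ^+ 2] from [sqnorm_cross_le]
    applied to each of the two classes. *)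
Lemma hardy_quotient_shift_ge (M eps : R) n :
  holomorphic theta1 -> holomorphic theta2 -> 0 < M -> 0 < eps ->
  (forall z, disk z -> normc (theta1 z) <= M) ->
  (forall z, disk z -> normc (theta2 z) <= M) ->
  (forall z, disk z -> eps <= normc (theta1 z) ^+ 2 + normc (theta2 z) ^+ 2) ->
  expR (-1) <= eps^-1 * (2 * M ^+ 2) *
    (hm_norm (hm_act 'X^n (class (0, hardy_one R))) ^+ 2 +
     hm_norm (hm_act 'X^n (class (hardy_one R, 0))) ^+ 2).
Proof.
move=> h1 h2 M0 eps0 M1 M2 e12.
pose F1 : tensorC2 H := (0 : hfun (hardy R), hardy_one R).
pose F2 : tensorC2 H := (hardy_one R, 0 : hfun (hardy R)).
have hc F := @holomorphic_cross _ (hardy R) theta1 theta2 F h1 h2.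
have NF F := sqnorm_cross_le (@hardy_sqnorm_ge0 R) F h1 h2 M0 M1 M2.
(* The action picks its own representatives; this replaces them by z^n [F1] and z^n [F2], whose
   determinants are explicit. *)
rewrite (@quotient_by_range_act _ _ theta1 theta2 'X^n F1).
rewrite (@quotient_by_range_act _ _ theta1 theta2 'X^n F2).
have V0 : 0 <= eps^-1 by rewrite invr_ge0 ltW.
rewrite -lee_fin; apply: le_trans (hardy_monomial_ge R n) _.
apply: (@le_trans _ _
  (eps^-1%:E * hardy R (cross theta1 theta2 (hm_act 'X^n F1)) +
   eps^-1%:E * hardy R (cross theta1 theta2 (hm_act 'X^n F2)))%E).
  apply: (@sqnorm_dom R (hardy R) _ _ _ _ _ V0 V0 (hc _) (hc _)).
    exact: hfun_holomorphic.
  move=> z Dz.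
  have -> : cross theta1 theta2 (hm_act 'X^n F1) z =
      theta1 z * (hm_act 'X^n (hardy_one R : H) : hfun (hardy R)) z.
    by rewrite /cross /= !mulr0 subr0.
  have -> : cross theta1 theta2 (hm_act 'X^n F2) z =
      - (theta2 z * (hm_act 'X^n (hardy_one R : H) : hfun (hardy R)) z).
    by rewrite /cross /= !mulr0 sub0r.
  move: ((hm_act 'X^n (hardy_one R : H) : hfun (hardy R)) z) => u.
  rewrite normcN !normcM !exprMn -mulrDr -mulrDl mulrA.
  (* What remains is the corona condition divided by [eps]. *)
  apply: ler_peMl; first exact: sqr_ge0.
  by rewrite mulrC ler_pdivlMr// mul1r e12.
rewrite -ge0_muleDr ?hardy_sqnorm_ge0// -mulrA EFinM.
apply: lee_wpmul2l; rewrite ?lee_fin// mulrDr EFinD.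
by apply: leeD; exact: NF.
Qed.

End HardyQuotient.

Theorem theorem4p7 (R : realType) (alpha : R) (halpha : -1 < alpha)
    (theta1 theta2 phi1 phi2 : R[i] -> R[i])
    (htheta1 : bounded_holomorphic theta1)
    (htheta2 : bounded_holomorphic theta2)
    (hphi1 : bounded_holomorphic phi1)
    (hphi2 : bounded_holomorphic phi2)
    (htheta : corona theta1 theta2) (hphi : corona phi1 phi2) :
  ~ isomorphic (quotient_by_range (hardy R) theta1 theta2)
               (quotient_by_range (bergman halpha) phi1 phi2).
Proof.
move=> [X [uX XM]].
have [h1 [B1 b1]] := htheta1; have [h2 [B2 b2]] := htheta2.
have [eps eps0 e12] := htheta.
(* A common bound, made positive by the summand 1. *)
pose M := 1 + `|B1| + `|B2|.
have M0 : 0 < M by rewrite /M -addrA ltr_pwDl// addr_ge0.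
have M1 z : disk z -> normc (theta1 z) <= M.
  move=> /b1 /le_trans; apply; rewrite (le_trans (ler_norm _))// /M.
  by rewrite addrAC lerDr addr_ge0.
have M2 z : disk z -> normc (theta2 z) <= M.
  move=> /b2 /le_trans; apply; rewrite (le_trans (ler_norm _))// /M.
  by rewrite lerDr addr_ge0.
have XE x : hm_norm (X x) = hm_norm x.
  apply: unitary_norm => //.
  - by apply: quotient_norm0; exact: hardy_sqnorm_ge0.
  - by apply: quotient_norm0; exact: bergman_sqnorm_ge0.
  - by move=> y; apply: quotient_norm_ge0 => G; exact: sqrtr_ge0.
  - by move=> y; apply: quotient_norm_ge0 => G; exact: sqrtr_ge0.
(* The isometry [X] commutes with z^n, so decay in the Bergman quotient carries over to the Hardy
   quotient. *)
have cvg0 (y : quotient_by_range (hardy R) theta1 theta2) :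
    hm_norm (hm_act 'X^n y) ^+ 2 @[n --> \oo] --> 0.
  under eq_fun do rewrite -XE XM.
  exact: bergman_quotient_shift_cvg0.
have lower n :=
  @hardy_quotient_shift_ge R theta1 theta2 M eps n h1 h2 M0 eps0 M1 M2 e12.
pose K := eps^-1 * (2 * M ^+ 2).
have cvgK (y1 y2 : quotient_by_range (hardy R) theta1 theta2) :
    K * (hm_norm (hm_act 'X^n y1) ^+ 2 + hm_norm (hm_act 'X^n y2) ^+ 2)
      @[n --> \oo] --> K * (0 + 0).
  by apply: cvgM; [exact: cvg_cst|exact: (cvgD (cvg0 _) (cvg0 _))].
(* The lower bound is uniform in n, so it survives in the limit and contradicts positivity of
   [expR]. *)
suff : expR (-1) <= K * (0 + 0) by rewrite addr0 mulr0 leNgt expR_gt0.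
exact: (ler_cvg_to (cvg_cst (expR (-1))) (cvgK _ _) (nearW _ lower)).
Qed.
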